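(* For every 2-permutation $w\in\mathfrak{S}_{\mathcal{N}}$, the Greedy Strategy for Two-color Patience Sorting forms the fewest number of piles possible: no strategy for Two-color Patience Sorting applied to $w$ ends with fewer piles.
   Context: Let $[n]=\{1,\dots,n\}$, $[\bar n]=\{\bar1,\dots,\bar n\}$ and $\mathcal{N}=[n]\cup[\bar n]$ (barred and unbarred cards are the two colors). A 2-permutation is a word $w=w_1\cdots w_{2n}$ using each element of $\mathcal{N}$ exactly once; $\mathfrak{S}_{\mathcal{N}}$ is the set of these. For $x\in\mathcal{N}$, $x^{\pm}$ denotes its numeric value ignoring the bar; $\mathrm{bar}(x,y)=1$ if exactly one of $x,y$ is barred and $0$ otherwise. Two-color Patience Sorting: $w_1$ is placed in a pile by itself; for $i=2,\dots,2n$, $w_i$ is either put into a new pile or played on top of any pile whose current top card $d$ satisfies $d^{\pm}>w_i^{\pm}$ and $\mathrm{bar}(w_i,d)=1$; the objective is to end with as few piles as possible. Greedy Strategy: if some pile has top card $d$ with $d^{\pm}>w_i^{\pm}$ and $\mathrm{bar}(w_i,d)=1$, play $w_i$ on the pile whose such top card has the smallest value; otherwise form a new pile. *)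

(* Defs.v *)
From mathcomp Require Import all_boot.

Set Implicit Arguments.
Unset Strict Implicit.
Unset Printing Implicit Defensive.

(* The card (v, b) has numeric value v.+1 in [1, n], and is barred iff b.
   Only the order of the values matters, so v itself serves as the value. *)
Definition color_card (n : nat) : Type := ('I_n * bool)%type.

Definition value (n : nat) (x : color_card n) : nat := x.1.

Definition bar (n : nat) (x y : color_card n) : bool := x.2 (+) y.2.

Definition two_permutation (n : nat) (w : seq (color_card n)) : Prop :=
  forall x : color_card n, count_mem x w = 1.

(* The head of a pile is its top card. *)
Definition pile (n : nat) : Type := seq (color_card n).

Definition accepts (n : nat) (c : color_card n) (p : pile n) : bool :=
  if p is d :: _ then (value d > value c) && bar c d else false.

(* None forms a new pile; Some i plays on the pile of index i. *)
Definition move : Type := option nat.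

Definition legal_move (n : nat) (ps : seq (pile n)) (c : color_card n)
    (m : move) : bool :=
  if m is Some i then (i < size ps) && accepts c (nth [::] ps i) else true.

Definition make_move (n : nat) (ps : seq (pile n)) (c : color_card n)
    (m : move) : seq (pile n) :=
  if m is Some i then set_nth [::] ps i (c :: nth [::] ps i)
  else rcons ps [:: c].

(* sigma dealt ps c rest is the move chosen for the card c when the cards dealt
   so far are dealt, the current piles are ps, and the cards still to come are
   rest: strategies may use full knowledge of the word. *)
Definition strategy (n : nat) : Type :=
  seq (color_card n) -> seq (pile n) -> color_card n -> seq (color_card n) ->
  move.

Fixpoint run_from (n : nat) (sigma : strategy n) (dealt : seq (color_card n))
    (ps : seq (pile n)) (w : seq (color_card n)) : seq (pile n) :=
  if w is c :: rest then
    run_from sigma (rcons dealt c) (make_move ps c (sigma dealt ps c rest)) rest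
  else ps.

Fixpoint legal_from (n : nat) (sigma : strategy n) (dealt : seq (color_card n))
    (ps : seq (pile n)) (w : seq (color_card n)) : bool :=
  if w is c :: rest then
    let m := sigma dealt ps c rest in
    legal_move ps c m &&
    legal_from sigma (rcons dealt c) (make_move ps c m) rest
  else true.

(* Starting without piles forces the first card into a pile by itself. *)
Definition final_piles (n : nat) (sigma : strategy n)
    (w : seq (color_card n)) : seq (pile n) :=
  run_from sigma [::] [::] w.

Definition obeys_rules (n : nat) (sigma : strategy n)
    (w : seq (color_card n)) : bool :=
  legal_from sigma [::] [::] w.

(* The value 0 of the empty pile is junk: piles in play are never empty. *)
Definition top_value (n : nat) (p : pile n) : nat :=
  if p is d :: _ then value d else 0.

(* The tops accepting a given c all have the same color, so in actual play the
   one of smallest value is unique and pick has no freedom. *)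
Definition greedy (n : nat) : strategy n := fun _ ps c _ =>
  omap (@nat_of_ord (size ps))
    [pick i : 'I_(size ps) |
      accepts c (nth [::] ps i) &
      [forall j : 'I_(size ps), accepts c (nth [::] ps j) ==>
        (top_value (nth [::] ps i) <= top_value (nth [::] ps j))]].

(* Main.v *)
(* Domination: position G dominates position A when, for every color b and
   every threshold t, G has at most as many tops of color b and value at most t
   as A has. Letting t be large, G then has at most as many piles as A.
   Domination survives dealing a card c to both positions, G playing greedily
   and A arbitrarily: it could only fail if A covers a top of color b and value
   in (c, t] while G does not; but then, by greediness, G has no top of color b
   in (c, t] at all, so its count at t equals its count at c, which is at most
   the count of A at c, hence less than the count of A at t. *)
Require Import Defs.
From mathcomp Require Import all_boot.
From mathcomp Require Import zify.

Set Implicit Arguments.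
Unset Strict Implicit.
Unset Printing Implicit Defensive.

Definition low_top (n : nat) (b : bool) (t : nat) (p : pile n) : bool :=
  if p is d :: _ then (d.2 == b) && (value d <= t) else false.

Definition dominates (n : nat) (G A : seq (pile n)) : Prop :=
  forall b t, count (low_top b t) G <= count (low_top b t) A.

(** The value [[::]] for a new pile fails both [low_top] and [accepts]: opening a pile covers no
    top. *)
Definition covered (n : nat) (ps : seq (pile n)) (m : move) : pile n :=
  if m is Some i then nth [::] ps i else [::].

(** A move exchanges the covered top for [c]; the sum form avoids truncated subtraction. *)
Lemma count_make_move (n : nat) (ps : seq (pile n)) c m b t :
  legal_move ps c m ->
  count (low_top b t) (make_move ps c m) + low_top b t (covered ps m) =
  count (low_top b t) ps + low_top b t [:: c].
Proof.
case: m => [i|] /= => [/andP[lti _]|_]; last by rewrite -cats1 count_cat /=; lia.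
by rewrite set_nthE lti -[in RHS](cat_take_drop i ps) (drop_nth [::] lti)
  !count_cat /= -!addnA; congr (_ + _); rewrite addnCA [RHS]addnCA [X in _ + X]addnC.
Qed.

Lemma nonempty_make_move (n : nat) (ps : seq (pile n)) c m :
  legal_move ps c m -> [::] \notin ps -> [::] \notin make_move ps c m.
Proof.
case: m => [i|] /= => [/andP[lti _]|_]; last by rewrite mem_rcons inE.
rewrite set_nthE lti mem_cat inE /= negb_or => nps.
by apply/andP; split; apply: contra nps; [apply: mem_take | apply: mem_drop].
Qed.

Lemma greedy_legal (n : nat) dealt (ps : seq (pile n)) c rest :
  legal_move ps c (greedy dealt ps c rest).
Proof.
by rewrite /greedy; case: pickP => //= i /andP[acc _]; rewrite ltn_ord.
Qed.

(** Since [[::]] accepts nothing, this also rules out a new pile. *)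
Lemma greedy_covers_smallest (n : nat) dealt (ps : seq (pile n)) c rest q :
  q \in ps -> accepts c q ->
  let d := covered ps (greedy dealt ps c rest) in
  accepts c d /\ top_value d <= top_value q.
Proof.
move=> /(nthP [::])[j ltj <-] accj; rewrite /greedy.
case: pickP => /= [i /andP[acci /forallP min]|none].
  by split=> //; apply: (implyP (min (Ordinal ltj))).
(* An accepting pile of least top value exists, so [pick] cannot fail. *)
have := @arg_minnP _ (Ordinal ltj) (fun i => accepts c (nth [::] ps i))
  (fun i => top_value (nth [::] ps i)) accj.
case=> i acci min; have /negP[] := negbT (none i).
by rewrite acci; apply/forallP=> k; apply/implyP=> /min.
Qed.

Lemma dominates_greedy_move (n : nat) dealt (G A : seq (pile n)) c rest m :
  legal_move A c m -> dominates G A ->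
  dominates (make_move G c (greedy dealt G c rest)) (make_move A c m).
Proof.
move=> legA domGA b t.
have := count_make_move b t (greedy_legal dealt G c rest).
have := count_make_move b t legA.
have := domGA b t.
(* Both positions gain the same top [c], so only the covered tops matter. *)
suff: count (low_top b t) G + low_top b t (covered A m) <=
  count (low_top b t) A + low_top b t (covered G (greedy dealt G c rest)).
  by lia.
have [lowA|_] := boolP (low_top b t (covered A m)); last first.
  by have := domGA b t; lia.
have [accA inA] : accepts c (covered A m) /\ covered A m \in A.
  case: m legA lowA => //= i /andP[lti acci] _.
  by split=> //; apply: mem_nth.
(* Hence a top of color [b] accepts [c] exactly when its value exceeds that of [c]. *)
have bc : c.2 (+) b.
  by case: (covered A m) accA lowA => //= d _ /andP[_ bd] /andP[/eqP <- _].
have [/hasP[q qG /andP[accq lowq]]|noG] :=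
    boolP (has (predI (accepts c) (low_top b t)) G).
  (* Greedy covers a top of the same color as that of [q] and no larger, so both sides of the goal
     gain one. *)
  have [] := greedy_covers_smallest dealt rest qG accq.
  case: (covered G _) => // d p /= /andP[_ bd] dq.
  case: q lowq dq {qG accq} => // e q /= /andP[_ et] de.
  rewrite (leq_trans de et) andbT.
  have -> : d.2 == b.
    by move: bd bc; rewrite /bar; case: (c.2); case: (d.2); case: (b).
  by have := domGA b t; rewrite /=; lia.
have leG : count (low_top b t) G <= count (low_top b (value c)) G.
  have -> : count (low_top b t) G =
      count (predI (low_top b t) (low_top b (value c))) G.
    apply: eq_in_count => q /(hasPn noG).
    case: q => //= -[d1 d2] q; rewrite /bar /=.
    by case: (d2 =P b) => //= ->; rewrite bc; lia.
  by apply: sub_count => q /andP[].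
(* The top that [A] covers counts at [t] but not at [value c]. *)
have ltA : count (low_top b (value c)) A < count (low_top b t) A.
  have : 0 < count (predI (accepts c) (low_top b t)) A.
    by rewrite -has_count; apply/hasP; exists (covered A m) => //=; apply/andP.
  have := count_predUI (low_top b (value c))
    (predI (accepts c) (low_top b t)) A.
  have -> : count (predI (low_top b (value c))
      (predI (accepts c) (low_top b t))) A = 0.
    rewrite -(count_pred0 A); apply: eq_count => -[|d q] //=; lia.
  have : count (predU (low_top b (value c))
      (predI (accepts c) (low_top b t))) A <= count (low_top b t) A.
    apply: sub_count => -[|d q] //= /orP[/andP[-> dc]|/andP[_ ->]] //=.
    case: (covered A m) accA lowA => //= e _ /andP[ce _] /andP[_ et]; lia.
  by lia.
by have := domGA b (value c); lia.
Qed.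

(** All values are below [n], so the threshold [n] admits every top. *)
Lemma count_low_tops (n : nat) (ps : seq (pile n)) :
  count (low_top true n) ps + count (low_top false n) ps =
  count (predC1 [::]) ps.
Proof.
elim: ps => //= -[|[v b] p] ps IHps //=; rewrite /value /=.
by have := ltn_ord v; case: b; lia.
Qed.

Lemma dominates_size (n : nat) (G A : seq (pile n)) :
  [::] \notin G -> dominates G A -> size G <= size A.
Proof.
move=> neG domGA; apply: leq_trans (count_size (predC1 [::]) A).
have /eqP <- : count (predC1 [::]) G == size G.
  by rewrite -all_count; apply/allP=> p pG /=; apply: contraNneq neG => <-.
by rewrite -!count_low_tops leq_add.
Qed.

Lemma greedy_legal_from (n : nat) dealt (ps : seq (pile n)) w :
  legal_from (@greedy n) dealt ps w.
Proof. by elim: w dealt ps => //= c w IHw dealt ps; rewrite greedy_legal IHw. Qed.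

(** The two runs share only the cards to come, so the induction ranges over all histories and all
    dominated positions. *)
Lemma size_run_greedy (n : nat) (sigma : strategy n) dG dA G A w :
  [::] \notin G -> dominates G A -> legal_from sigma dA A w ->
  size (run_from (@greedy n) dG G w) <= size (run_from sigma dA A w).
Proof.
elim: w dG dA G A => [|c w IHw] dG dA G A neG domGA /=.
  by move=> _; apply: dominates_size.
case/andP=> legc legw; apply: IHw => //.
  exact: nonempty_make_move (greedy_legal _ _ _ _) neG.
exact: dominates_greedy_move.
Qed.

Theorem mainTheorem8 (n : nat) (w : seq (color_card n)) (Hw : two_permutation w) :
  obeys_rules (@greedy n) w /\
  forall sigma : strategy n, obeys_rules sigma w ->
    size (final_piles (@greedy n) w) <= size (final_piles sigma w).
Proof.
split; first exact: greedy_legal_from.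
by move=> sigma legw; apply: size_run_greedy.
Qed.
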